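(* Let $n\geq3$, $G=\mathrm{SL}_n(\mathbb{C})$, $H=\mathrm{SL}_{n-1}(\mathbb{C})$, and identify $G/H$ with $\{(x,y)\in\mathbb{C}^n\times\mathbb{C}^n:\sum_{i=1}^n x_iy_i=1\}$. For $0<t<1$ let $$\mathrm{sLog}_{\Gamma,t}(x,y)=\big(\log_t(|x_1|^2+\cdots+|x_n|^2),\ \log_t(|y_1|^2+\cdots+|y_n|^2)\big)\in\mathbb{R}^2 .$$ Then $\mathrm{sLog}_{\Gamma,t}(G/H)=\overline{\mathcal{V}}_{G/H}=\{(q_1,q_2)\in\mathbb{R}^2: q_1+q_2\leq0\}$ for all $0<t<1$. In particular, as $t\to0$ the sets $\mathrm{sLog}_{\Gamma,t}(G/H)$ converge to the valuation cone $\overline{\mathcal{V}}_{G/H}$ in the sense of Kuratowski.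
   Context: $\mathrm{SL}_n(\mathbb{C})$ acts on $\mathbb{C}^n\times\mathbb{C}^n$ by $A\cdot(v,w)=(Av,(A^t)^{-1}w)$; the stabilizer of $(e_1,e_1)$ is $\mathrm{SL}_{n-1}(\mathbb{C})$ (embedded as the lower right block) and its orbit is the affine variety $\{\sum x_iy_i=1\}$, which is a spherical homogeneous space. $\log_t(y)=\ln y/\ln t$. The map $\mathrm{sLog}_{\Gamma,t}$ is the spherical logarithm map for $\Gamma=\{\omega_{n-1},\omega_1\}$ (fundamental weights for the upper triangular Borel $B$), which freely generates the semigroup of highest weights of $\mathbb{C}[G/H]$; the corresponding $B$-eigenfunctions are $x_n$ and $y_1$, and the corresponding spherical functions are $\sum|x_i|^2$ and $\sum|y_i|^2$. The valuation cone is the set of images $(\nu(x_n),\nu(y_1))\in\mathbb{Q}^2$ of the $\mathrm{SL}_n(\mathbb{C})$-invariant discrete $\mathbb{Q}$-valued valuations $\nu$ of $\mathbb{C}(G/H)$ that are trivial on $\mathbb{C}^*$, and $\overline{\mathcal{V}}_{G/H}$ is its Euclidean closure in $\mathbb{R}^2$; it equals $\{(q_1,q_2)\in\mathbb{R}^2:q_1+q_2\leq0\}$. Kuratowski convergence of $X_t\subset\mathbb{R}^2$ to $X_0\subset\mathbb{R}^2$ as $t\to0^+$: (a) every $y\notin X_0$ has a neighbourhood $U$ and $\varepsilon>0$ with $X_t\cap U=\emptyset$ for $0<t<\varepsilon$; (b) for every $y\in X_0$ and every neighbourhood $U$ of $y$ there is $\varepsilon>0$ with $X_t\cap U\neq\emptyset$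 for $0<t<\varepsilon$. *)

(* Defs.v *)
From HB Require Import structures.
From mathcomp Require Import all_boot all_order all_algebra.
From mathcomp Require Import ring_quotient generic_quotient fraction.
(* mpoly must come before the MathComp-Analysis files: their notations clash
   when imported in the opposite order. *)
From mathcomp Require Import complex mpoly.
From mathcomp Require Import boolp classical_sets reals topology normedtype exp.

Set Implicit Arguments.
Unset Strict Implicit.
Unset Printing Implicit Defensive.

Import Order.TTheory GRing.Theory Num.Theory.
Import numFieldNormedType.Exports.

Local Open Scope classical_set_scope.
Local Open Scope ring_scope.
Local Open Scope quotient_scope.

(* The value of nu at 0, morally +oo, is left unspecified. *)
Definition is_valuation (K : fieldType) (nu : K -> rat) : Prop :=
  (forall f g : K, f != 0 -> g != 0 -> nu (f * g) = nu f + nu g) /\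
  (forall f g : K, f != 0 -> g != 0 -> f + g != 0 ->
     Num.min (nu f) (nu g) <= nu (f + g)).

(* The value group is c * int for some rational c; c = 0 is allowed, so that
   the trivial valuation counts as discrete. *)
Definition is_discrete (K : fieldType) (nu : K -> rat) : Prop :=
  exists c : rat, forall f : K, f != 0 -> exists k : int, nu f = c * k%:~R.

Definition kuratowski_cvg (R : realType) (T : topologicalType)
    (X : R -> set T) (X0 : set T) : Prop :=
  (forall y : T, ~ X0 y ->
     exists U : set T, nbhs y U /\
       exists eps : R, 0 < eps /\
         forall t : R, 0 < t -> t < eps -> X t `&` U = set0) /\
  (forall y : T, X0 y -> forall U : set T, nbhs y U ->
     exists eps : R, 0 < eps /\
       forall t : R, 0 < t -> t < eps -> X t `&` U !=set0).

Lemma fraction_numden (D : idomainType) (f : {fraction D}) :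
  f = tofrac (\n_(repr f)) / tofrac (\d_(repr f)).
Proof.
rewrite -[LHS]reprK; move: (repr f) => r; have r0 := denom_ratioP r.
apply/eqP; rewrite !piE /FracField.equivf /= /FracField.mulf /FracField.invf.
by rewrite !numden_Ratio ?mul1r ?oner_eq0 ?mulr1 ?mul1r // mulrC.
Qed.

(* Throughout, the dimension n of the ambient space C^n is m.+1. *)
Section HomogeneousSpace.
Variables (R : realType) (m : nat).
Local Notation n := m.+1.
Local Notation C := R[i].

(* G/H, identified with the orbit of (e_1, e_1). *)
Definition GH : set ('cV[C]_n * 'cV[C]_n) :=
  [set z : 'cV[C]_n * 'cV[C]_n | \sum_(i < n) z.1 i 0 * z.2 i 0 = 1].

(* Polynomials in the n + n coordinates x_1, .., x_n, y_1, .., y_n. *)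
Definition coords (z : 'cV[C]_n * 'cV[C]_n) : 'I_(n + n) -> C :=
  fun i => col_mx z.1 z.2 i 0.

Definition vanishing : {pred {mpoly C[n + n]}} :=
  fun p => `[< forall z, GH z -> p.@[coords z] = 0 >].

Lemma vanishingP p :
  reflect (forall z, GH z -> p.@[coords z] = 0) (p \in vanishing).
Proof. exact: asboolP. Qed.

Lemma GH_nonempty : GH !=set0.
Proof.
exists (delta_mx 0 0, delta_mx 0 0).
rewrite /GH /= (bigD1 ord0) //= big1 ?addr0 ?mxE ?eqxx ?mulr1 //.
by move=> i i0; rewrite !mxE (negbTE i0) mul0r.
Qed.

Lemma vanishing_idealr : idealr_closed vanishing.
Proof.
split.
- by apply/vanishingP => z _; rewrite raddf0.
- apply/vanishingP => /(_ _ (svalP (cid GH_nonempty))).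
  by rewrite rmorph1 => /eqP; rewrite oner_eq0.
- move=> a u v /vanishingP hu /vanishingP hv; apply/vanishingP => z hz.
  by rewrite rmorphD rmorphM /= hu ?hv // mulr0 addr0.
Qed.

(* Irreducibility of GH: (x, y) and (x', y') are joined by the rational curve
   s |-> (x(s), y(s) / <x(s), y(s)>) where x(s) and y(s) are the affine
   interpolations. *)
Section Curve.
Variables z w : 'cV[C]_n * 'cV[C]_n.

Let seg (a b : C) : {poly C} := a%:P + (b - a) *: 'X.
Let xs i := seg (z.1 i 0) (w.1 i 0).
Let ys i := seg (z.2 i 0) (w.2 i 0).
Let d : {poly C} := \sum_(i < n) xs i * ys i.
Let curve (s : C) : 'cV[C]_n * 'cV[C]_n :=
  (\col_i (xs i).[s], \col_i ((ys i).[s] / d.[s])).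

Let seg0 a b : (seg a b).[0] = a.
Proof. by rewrite /seg hornerD hornerC hornerZ hornerX mulr0 addr0. Qed.

Let seg1 a b : (seg a b).[1] = b.
Proof. by rewrite /seg hornerD hornerC hornerZ hornerX mulr1 addrC subrK. Qed.

Let hornerd s : d.[s] = \sum_(i < n) (xs i).[s] * (ys i).[s].
Proof. by rewrite /d horner_sum; apply: eq_bigr => i _; rewrite hornerM. Qed.

Let curve_GH s : d.[s] != 0 -> GH (curve s).
Proof.
move=> ds; rewrite /GH /=.
under eq_bigr do rewrite !mxE mulrA.
by rewrite -mulr_suml -hornerd divff.
Qed.

Let curve_poly (p : {mpoly C[n + n]}) : exists N (P : {poly C}),
  forall s, d.[s] != 0 -> P.[s] = d.[s] ^+ N * p.@[coords (curve s)].
Proof.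
pose Q (p : {mpoly C[n + n]}) := exists N (P : {poly C}),
  forall s, d.[s] != 0 -> P.[s] = d.[s] ^+ N * p.@[coords (curve s)].
have QC c : Q c%:MP.
  by exists 0%N, c%:P => s _; rewrite mevalC expr0 mul1r hornerC.
have QD a b : Q a -> Q b -> Q (a + b).
  move=> [N [P hP]] [N' [P' hP']].
  exists (N + N')%N, (d ^+ N' * P + d ^+ N * P') => s ds.
  by rewrite !hornerE hP // hP' // rmorphD exprD mulrDr !mulrA
    [X in X * _ + _]mulrC.
have QM a b : Q a -> Q b -> Q (a * b).
  move=> [N [P hP]] [N' [P' hP']].
  exists (N + N')%N, (P * P') => s ds.
  by rewrite !hornerE hP // hP' // rmorphM exprD mulrACA.
have QX i : Q 'X_i.
  case: (splitP i) => j ij.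
  - exists 0%N, (xs j) => s _.
    rewrite mevalXU expr0 mul1r /coords.
    have -> : i = lshift n j by apply: val_inj.
    by rewrite col_mxEu mxE.
  - exists 1%N, (ys j) => s ds.
    rewrite mevalXU expr1 /coords.
    have -> : i = rshift n j by apply: val_inj.
    by rewrite col_mxEd mxE mulrCA divff // mulr1.
rewrite -/(Q p) [p]mpolyE; apply: (big_ind Q) => //; first exact: (QC 0).
move=> k _; rewrite -mul_mpolyC; apply: (QM _ _ (QC _)).
rewrite mpolyXE_id; apply: (big_ind Q) => //; first exact: (QC 1).
move=> i _; elim: (k i) => [|e IH]; first exact: (QC 1).
by rewrite exprS; apply: QM.
Qed.

Lemma vanishing_curve p q : GH z -> GH w -> p * q \in vanishing ->
  p.@[coords z] = 0 \/ q.@[coords w] = 0.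
Proof.
move=> zX wX /vanishingP pq0.
have d0 : d.[0] = 1.
  by rewrite hornerd -[RHS]zX; apply: eq_bigr => i _; rewrite !seg0.
have d1 : d.[1] = 1.
  by rewrite hornerd -[RHS]wX; apply: eq_bigr => i _; rewrite !seg1.
have c0 : curve 0 = z.
  rewrite /curve [RHS]surjective_pairing; congr pair.
  - by apply/colP => i; rewrite mxE seg0.
  - by apply/colP => i; rewrite mxE seg0 d0 divr1.
have c1 : curve 1 = w.
  rewrite /curve [RHS]surjective_pairing; congr pair.
  - by apply/colP => i; rewrite mxE seg1.
  - by apply/colP => i; rewrite mxE seg1 d1 divr1.
have [N [P hP]] := curve_poly p; have [M [Q hQ]] := curve_poly q.
have PQd0 : P * Q * d = 0.
  apply/eqP; apply: contraT => nz.
  pose rs := [seq k%:R : C | k <- iota 0 (size (P * Q * d))].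
  have rsu : uniq rs.
    by rewrite map_inj_uniq ?iota_uniq // => a b /eqP; rewrite eqr_nat => /eqP.
  have rsr : all (root (P * Q * d)) rs.
    apply/allP => s _; rewrite /root !hornerM.
    have [->|ds] := eqVneq d.[s] 0; first by rewrite mulr0.
    rewrite hP // hQ // mulrACA -[p.@[_] * _]rmorphM /= pq0 ?mulr0 ?mul0r //.
    exact: curve_GH.
  by have := max_poly_roots nz rsr rsu; rewrite size_map size_iota ltnn.
have := PQd0 => /eqP; rewrite !mulf_eq0 -orbA => /or3P[] /eqP h.
- left; have := hP 0; rewrite h d0 oner_eq0 c0 horner0 expr1n mul1r.
  by move=> /(_ isT).
- right; have := hQ 1; rewrite h d1 oner_eq0 c1 horner0 expr1n mul1r.
  by move=> /(_ isT).
- by move: d0; rewrite h horner0 => /eqP; rewrite eq_sym oner_eq0.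
Qed.

End Curve.

Lemma vanishing_prime : prime_idealr_closed vanishing.
Proof.
move=> p q pq; case: (boolP (p \in vanishing)) => //=.
move=> /asboolPn/existsNP[z /not_implyP[zX pz]]; apply/vanishingP => w wX.
by have [] := vanishing_curve zX wX pq.
Qed.

HB.instance Definition _ :=
  isIdealr.Build {mpoly C[n + n]} vanishing vanishing_idealr.
HB.instance Definition _ :=
  isPrimeIdealrClosed.Build {mpoly C[n + n]} vanishing vanishing_prime.

(* The coordinate ring C[G/H], with function field funGH below. The library only makes quotients by prime ideals
   commutative rings: units and inverses are added here. *)
Definition regGH : Type := {ideal_quot vanishing}.
HB.instance Definition _ := EqQuotient.on regGH.
HB.instance Definition _ := GRing.ComNzRing.on regGH.

Definition regGH_unit : {pred regGH} := fun u => `[< exists v, v * u = 1 >].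
Definition regGH_inv (u : regGH) : regGH :=
  if pselect (exists v, v * u = 1) is left h then sval (cid h) else u.

Lemma regGH_mulVx : {in regGH_unit, left_inverse 1 regGH_inv *%R}.
Proof.
by move=> u /asboolP hu; rewrite /regGH_inv; case: pselect => // h; case: cid.
Qed.

Lemma regGH_unitP (u v : regGH) : v * u = 1 -> regGH_unit u.
Proof. by move=> vu; apply/asboolP; exists v. Qed.

Lemma regGH_inv_out : {in [predC regGH_unit], regGH_inv =1 id}.
Proof.
by move=> u /asboolPn hu; rewrite /regGH_inv; case: pselect.
Qed.

HB.instance Definition _ := GRing.ComNzRing_hasMulInverse.Build regGH
  regGH_mulVx regGH_unitP regGH_inv_out.

Lemma regGH_idomain : GRing.integral_domain_axiom regGH.
Proof. move=> u v; exact: (@Quotient.rquot_IdomainAxiom _ vanishing). Qed.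

HB.instance Definition _ :=
  GRing.ComUnitRing_isIntegral.Build regGH regGH_idomain.

Definition funGH : fieldType := {fraction regGH}.

Definition regular (p : {mpoly C[n + n]}) : regGH := \pi p.

Lemma regular_is_zmod_morphism : zmod_morphism regular.
Proof. exact: raddfB. Qed.

Lemma regular_is_monoid_morphism : monoid_morphism regular.
Proof. by split; [exact: rmorph1 | exact: rmorphM]. Qed.

HB.instance Definition _ := GRing.isZmodMorphism.Build
  {mpoly C[n + n]} regGH regular regular_is_zmod_morphism.
HB.instance Definition _ := GRing.isMonoidMorphism.Build
  {mpoly C[n + n]} regGH regular regular_is_monoid_morphism.

Lemma regularK u : regular (repr u) = u.
Proof. exact: reprK. Qed.

Lemma regular_eq p q : regular p = regular q <->
  forall z, GH z -> p.@[coords z] = q.@[coords z].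
Proof.
have -> : (regular p = regular q) <-> (p - q \in vanishing).
  by rewrite Quotient.idealrBE; split=> [h|/eqP//]; apply/eqP.
split=> [/vanishingP h z zX | h]; last apply/vanishingP => z zX.
- by apply/eqP; rewrite -subr_eq0 -rmorphB /= h.
- by rewrite rmorphB /= h // subrr.
Qed.

Definition fregular (p : {mpoly C[n + n]}) : funGH := tofrac (regular p).

(* The linear action of SL_n on C^n x C^n, and the induced substitution
   f |-> f \o SLact A on polynomials, on C[G/H] and on C(G/H). This is the
   action of A^-1 on functions. *)
Definition SLact (A : 'M[C]_n) (z : 'cV[C]_n * 'cV[C]_n) :
    'cV[C]_n * 'cV[C]_n :=
  (A *m z.1, invmx A^T *m z.2).

Definition pull_poly (A : 'M[C]_n) (p : {mpoly C[n + n]}) :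
    {mpoly C[n + n]} :=
  p \mPo [tuple \sum_(j < n + n) block_mx A 0 0 (invmx A^T) i j *: 'X_j
         | i < n + n].

Definition pull_reg (A : 'M[C]_n) (u : regGH) : regGH :=
  regular (pull_poly A (repr u)).

Definition pull (A : 'M[C]_n) (f : funGH) : funGH :=
  tofrac (pull_reg A (\n_(repr f))) / tofrac (pull_reg A (\d_(repr f))).

Lemma pull_polyE A p z : (pull_poly A p).@[coords z] = p.@[coords (SLact A z)].
Proof.
rewrite /pull_poly comp_mpolyEX rmorph_sum /= mevalE; apply: eq_bigr => k _.
rewrite mevalZ comp_mpolyX rmorph_prod /=; congr (_ * _).
apply: eq_bigr => i _; rewrite rmorphXn /= tnth_mktuple rmorph_sum /=.
congr (_ ^+ _); rewrite /coords /SLact /=.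
have -> : col_mx (A *m z.1) (invmx A^T *m z.2)
    = block_mx A 0 0 (invmx A^T) *m col_mx z.1 z.2.
  by rewrite mul_block_col !mul0mx addr0 add0r.
by rewrite mxE; apply: eq_bigr => j _; rewrite mevalZ mevalXU.
Qed.

Lemma SLact_GH A z : \det A = 1 -> GH z -> GH (SLact A z).
Proof.
move=> dA; have uA : A^T \in unitmx by rewrite unitmxE det_tr dA unitr1.
have GHE w : GH w <-> (w.1^T *m w.2) 0 0 = 1.
  rewrite /GH /= mxE.
  by under [X in _ <-> X = _]eq_bigr do rewrite [w.1^T _ _]mxE.
rewrite !GHE /SLact /= => <-.
by rewrite trmx_mul mulmxA -(mulmxA _ A^T) mulmxV // mulmx1.
Qed.

Lemma pull_regE A p : \det A = 1 ->
  pull_reg A (regular p) = regular (pull_poly A p).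
Proof.
move=> dA; apply: (proj2 (regular_eq _ _)) => z zX.
rewrite [LHS]pull_polyE [RHS]pull_polyE.
by apply: (proj1 (regular_eq _ _)) (SLact_GH dA zX); rewrite regularK.
Qed.

Lemma pull_reg_eq0 A u : \det A = 1 -> (pull_reg A u == 0) = (u == 0).
Proof.
move=> dA; have uA : A \in unitmx by rewrite unitmxE dA unitr1.
have dV : \det (invmx A) = 1 by rewrite det_inv dA invr1.
have AK z : SLact A (SLact (invmx A) z) = z.
  rewrite /SLact /= !mulmxA mulmxV // mul1mx -!trmx_inv invmxK -trmx_mul.
  by rewrite mulmxV // trmx1 mul1mx -surjective_pairing.
rewrite -(regularK u) (pull_regE _ dA).
have -> : 0 = regular 0 by exact/esym/raddf0.
apply/eqP/eqP => /(proj1 (regular_eq _ _)) h;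
  apply: (proj2 (regular_eq _ _)) => z zX.
- by have := h _ (SLact_GH dV zX); rewrite [LHS]pull_polyE AK !raddf0.
- by rewrite [LHS]pull_polyE h ?raddf0 //; apply: SLact_GH.
Qed.

Lemma pull_regM A u v : \det A = 1 ->
  pull_reg A (u * v) = pull_reg A u * pull_reg A v.
Proof.
move=> dA; rewrite -(regularK u) -(regularK v) -rmorphM !pull_regE //.
by rewrite -[RHS]rmorphM; congr regular; exact: rmorphM.
Qed.

Lemma pullE A u v : \det A = 1 -> v != 0 ->
  pull A (tofrac u / tofrac v) = tofrac (pull_reg A u) / tofrac (pull_reg A v).
Proof.
move=> dA v0; set f := tofrac u / tofrac v; rewrite /pull.
set a := \n_(repr f); set b := \d_(repr f).
have b0 : b != 0 by exact: denom_ratioP.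
have ab : f = tofrac a / tofrac b by exact: fraction_numden.
have cross : a * v = u * b.
  apply/eqP; rewrite -tofrac_eq !tofracM -eqr_div ?tofrac_eq0 //.
  by rewrite -ab.
have nz w : w != 0 -> tofrac (pull_reg A w) != 0.
  by move=> w0; rewrite tofrac_eq0 (pull_reg_eq0 _ dA).
apply/eqP; rewrite (eqr_div _ _ (nz b b0) (nz v v0)).
have crossA : pull_reg A a * pull_reg A v = pull_reg A u * pull_reg A b.
  by rewrite -(pull_regM a v dA) cross (pull_regM u b dA).
by apply/eqP; rewrite -[LHS]tofracM crossA [LHS]tofracM.
Qed.

Definition invariant_valuation (nu : funGH -> rat) : Prop :=
  [/\ is_valuation nu, is_discrete nu,
      (forall c : C, c != 0 -> nu (fregular c%:MP) = 0) &
      (forall (A : 'M[C]_n) (f : funGH), \det A = 1 -> f != 0 ->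
         nu (pull A f) = nu f)].

(* x_n and y_1, the B-eigenfunctions of weights omega_{n-1} and omega_1. *)
Definition x_last : funGH := fregular 'X_(lshift n ord_max).
Definition y_first : funGH := fregular 'X_(rshift n ord0).

(* In the coordinates of Hom(Lambda, Q) dual to omega_{n-1}, omega_1. *)
Definition valuation_cone : set (rat * rat) :=
  [set q | exists nu, invariant_valuation nu /\ q = (nu x_last, nu y_first)].

Definition valuation_cone_closure : set (R * R) :=
  closure [set ((ratr q.1, ratr q.2) : R * R) | q in valuation_cone].

Definition sqnorm (x : 'cV[C]_n) : R :=
  \sum_(i < n) ComplexField.Normc.normc (x i 0) ^+ 2.

Definition log (t y : R) : R := ln y / ln t.

Definition sLog (t : R) (z : 'cV[C]_n * 'cV[C]_n) : R * R :=
  (log t (sqnorm z.1), log t (sqnorm z.2)).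

End HomogeneousSpace.

Arguments GH : clear implicits.
Arguments vanishing : clear implicits.
Arguments regGH : clear implicits.
Arguments funGH : clear implicits.
Arguments valuation_cone : clear implicits.
Arguments valuation_cone_closure : clear implicits.

(* Main.v *)
(* An SL_n-invariant valuation nu takes a single value on all x_i and a single
   value on all y_j, since signed transpositions permute the coordinates; the
   relation 1 = \sum_i x_i y_i then gives nu(x_n) + nu(y_1) <= 0. Conversely,
   for integers a + b <= 0, the curves
     t |-> (t^a u, (t^-a - t^b) v + t^b w)   with <u, v> = <u, w> = 1
   lie in G/H and SL_n permutes them. The smallest order at t = 0 of a regular
   function along these curves is therefore invariant. It is multiplicative
   because any two curves are joined by a rational family of curves, along which
   the smallest order is attained at all but finitely many parameters. It takes
   the values a on x_n and b on y_1, so rescaling gives every rational point of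
   the half-plane. The image of sLog is the same half-plane: one inclusion is the
   Cauchy-Schwarz inequality |x|^2 |y|^2 >= 1, the other an explicit point. *)

Require Import Defs.
From mathcomp Require Import all_boot all_order all_algebra.
From mathcomp Require Import generic_quotient fraction complex mpoly.
From mathcomp Require Import zify ring lra.
From mathcomp Require Import boolp classical_sets reals topology normedtype.
From mathcomp Require Import sequences exp.

Import Order.TTheory GRing.Theory Num.Theory.
Import numFieldNormedType.Exports.

Local Open Scope classical_set_scope.
Local Open Scope ring_scope.

(** * Orders of Laurent polynomials *)

Section LaurentOrder.
Set Implicit Arguments.
Unset Strict Implicit.
Variable F : numFieldType.
Implicit Types (f g : F -> F) (k l : int) (P Q : {poly F}).

(** [F] has characteristic 0, so the first [size P] numerals are distinct points, more than a
    nonzero [P] can have as roots. *)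
Lemma exists_nonroot P : P != 0 -> exists s, P.[s] != 0.
Proof.
move=> P0; apply: contrapT => /forallNP all_root.
pose rs := [seq i%:R : F | i <- iota 0 (size P)].
have rsu : uniq rs.
  by rewrite map_inj_uniq ?iota_uniq // => a b /eqP; rewrite eqr_nat => /eqP.
have rsr : all (root P) rs.
  by apply/allP => s _; rewrite /root; apply/negPn/negP/all_root.
by have := max_poly_roots P0 rsr rsu; rewrite size_map size_iota ltnn.
Qed.

Lemma poly_eq_nonroot (d P Q : {poly F}) : d != 0 ->
  (forall t, d.[t] != 0 -> P.[t] = Q.[t]) -> P = Q.
Proof.
move=> d0 eqPQ; apply/eqP; rewrite -subr_eq0; apply/negPn/negP => PQ0.
have /exists_nonroot[s] : d * (P - Q) != 0 by rewrite mulf_neq0.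
rewrite hornerM mulf_eq0 negb_or => /andP[ds].
by rewrite hornerD hornerN eqPQ // subrr eqxx.
Qed.

Lemma poly_eq_punctured P Q :
  (forall t, t != 0 -> P.[t] = Q.[t]) -> P = Q.
Proof.
move=> eqPQ; apply: (@poly_eq_nonroot 'X); first by rewrite polyX_eq0.
by move=> t; rewrite hornerX; apply: eqPQ.
Qed.

(** Laurent polynomials are handled as functions off [t = 0], where negative powers make sense. The
    zero function satisfies the bound for every [k]. *)
Definition ord_ge f k :=
  exists P, forall t, t != 0 -> f t = t ^ k * P.[t].

Definition ord_eq f k :=
  exists2 P, P.[0] != 0 & forall t, t != 0 -> f t = t ^ k * P.[t].

Lemma ord_eq_ge f k : ord_eq f k -> ord_ge f k.
Proof. by case=> P _ fP; exists P. Qed.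

Lemma ord_ge_le f k l : l <= k -> ord_ge f k -> ord_ge f l.
Proof.
move=> lk [P fP]; exists ('X^`|k - l|%N * P) => t t0.
rewrite fP // hornerM hornerXn mulrA exprnP -expfzDr //.
by congr (t ^ _ * _); lia.
Qed.

(** If [k < l], comparing the two expressions makes [P] divisible by a positive power of ['X],
    against [P.[0] != 0]. *)
Lemma ord_eq_max f k l : ord_eq f k -> ord_ge f l -> l <= k.
Proof.
move=> [P P0 fP] [Q fQ]; rewrite leNgt; apply/negP => kl.
have lk0 : (0 < `|l - k|)%N by rewrite absz_gt0 subr_eq0 gt_eqF.
have PQ : P = 'X^`|l - k|%N * Q.
  apply: poly_eq_punctured => t t0; rewrite hornerM hornerXn.
  apply: (@mulfI _ (t ^ k)); first exact: expfz_neq0.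
  rewrite -fP // fQ // mulrA exprnP -expfzDr //.
  by congr (t ^ _ * _); lia.
by move: P0; rewrite PQ hornerM hornerXn expr0n eqn0Ngt lk0 mul0r eqxx.
Qed.

Lemma ord_ge_ext f g k : (forall t, t != 0 -> f t = g t) ->
  ord_ge f k -> ord_ge g k.
Proof. by move=> fg [P fP]; exists P => t t0; rewrite -fg // fP. Qed.

Lemma ord_eq_ext f g k : (forall t, t != 0 -> f t = g t) ->
  ord_eq f k -> ord_eq g k.
Proof. by move=> fg [P P0 fP]; exists P => // t t0; rewrite -fg // fP. Qed.

Lemma ord_eqM f g k l : ord_eq f k -> ord_eq g l ->
  ord_eq (fun t => f t * g t) (k + l).
Proof.
move=> [P P0 fP] [Q Q0 gQ]; exists (P * Q); first by rewrite hornerM mulf_neq0.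
by move=> t t0; rewrite fP // gQ // hornerM expfzDr // mulrACA.
Qed.

Lemma ord_geM f g k l : ord_ge f k -> ord_ge g l ->
  ord_ge (fun t => f t * g t) (k + l).
Proof.
move=> [P fP] [Q gQ]; exists (P * Q).
by move=> t t0; rewrite fP // gQ // hornerM expfzDr // mulrACA.
Qed.

Lemma ord_geD f g k : ord_ge f k -> ord_ge g k ->
  ord_ge (fun t => f t + g t) k.
Proof.
move=> [P fP] [Q gQ]; exists (P + Q).
by move=> t t0; rewrite fP // gQ // hornerD mulrDr.
Qed.

(** In the second case [j] is the multiplicity of 0 as a root of [P]. *)
Lemma ord_eq_exists f k P : (forall t, t != 0 -> f t = t ^ k * P.[t]) ->
  (forall t, t != 0 -> f t = 0) \/ exists j : nat, ord_eq f (k + j%:Z).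
Proof.
move=> fP; have [P0|P0] := eqVneq P 0.
  by left=> t t0; rewrite fP // P0 horner0 mulr0.
right; have [j [Q]] := multiplicity_XsubC P 0.
rewrite P0 subr0 /root /= => Q0 PQ; exists j, Q => // t t0.
by rewrite fP // PQ hornerM hornerXn expfzDr // mulrCA mulrC.
Qed.

End LaurentOrder.

(** * Orders along a family of curves in G/H *)

Section Family.
Set Implicit Arguments.
Unset Strict Implicit.
Variables (R : realType) (m : nat) (a b : int).
Local Notation n := m.+1.
Local Notation C := R[i].
Local Notation triple := ('cV[C]_n * 'cV[C]_n * 'cV[C]_n)%type.

Definition family : set triple :=
  [set h | GH R m h.1 /\ GH R m (h.1.1, h.2)].

(* For [h = (u, v, w)] with [<u, v> = <u, w> = 1] this is a curve in GH; when
   [a + b <= 0], generically [x] has order [a] and [y] has order [b]. *)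
Definition germ (h : triple) (t : C) : 'cV[C]_n * 'cV[C]_n :=
  (t ^ a *: h.1.1, (t ^ (- a) - t ^ b) *: h.1.2 + t ^ b *: h.2).

(** The pairing of the two components is [t ^ a * ((t ^ (- a) - t ^ b) + t ^ b) = 1]. *)
Lemma germ_GH h t : family h -> t != 0 -> GH R m (germ h t).
Proof.
move=> [h1 h2] t0; rewrite /GH /=.
under eq_bigr do rewrite !mxE mulrDr mulrACA (mulrACA _ _ _ (h.2 _ _)).
rewrite big_split /= -!mulr_sumr h1 h2 !mulr1 mulrBr -expfzDr // subrr expr0z.
by rewrite subrK.
Qed.

Lemma family_diag z : GH R m z -> family (z.1, z.2, z.2).
Proof. by case: z. Qed.

(** Every point of G/H thus lies on a curve of the family, so a polynomial that is nonzero somewhere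
    on G/H has a nonzero pullback. *)
Lemma germ1 z : germ (z.1, z.2, z.2) 1 = z.
Proof.
rewrite /germ /= !exp1rz subrr scale0r add0r !scale1r.
by case: z.
Qed.

(** * Rational curves inside the family *)

Section Curve.
Variables h0 h1 : triple.

Definition segment (c e : C) : {poly C} := c%:P + (e - c) *: 'X.

Lemma segment0 c e : (segment c e).[0] = c.
Proof. by rewrite /segment hornerD hornerC hornerZ hornerX mulr0 addr0. Qed.

Lemma segment1 c e : (segment c e).[1] = e.
Proof. by rewrite /segment hornerD hornerC hornerZ hornerX mulr1 addrC subrK. Qed.

Let us i := segment (h0.1.1 i 0) (h1.1.1 i 0).
Let vs i := segment (h0.1.2 i 0) (h1.1.2 i 0).
Let ws i := segment (h0.2 i 0) (h1.2 i 0).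
Let dv : {poly C} := \sum_(i < n) us i * vs i.
Let dw : {poly C} := \sum_(i < n) us i * ws i.

Definition curve_den : {poly C} := dv * dw.

(** Affine interpolation from [h0] to [h1]; dividing [v] and [w] by their pairings with [u] brings
    the result back into the family. *)
Definition curve (s : C) : triple :=
  (\col_i (us i).[s], \col_i ((vs i).[s] / dv.[s]),
   \col_i ((ws i).[s] / dw.[s])).

Lemma curve_family s : curve_den.[s] != 0 -> family (curve s).
Proof.
rewrite /curve_den hornerM mulf_eq0 negb_or => /andP[v0 w0].
split; rewrite /GH /=; under eq_bigr do rewrite !mxE mulrA -hornerM.
  by rewrite -mulr_suml -horner_sum divff.
by rewrite -mulr_suml -horner_sum divff.
Qed.

Let curve_at s h : family h ->
  (forall i, (us i).[s] = h.1.1 i 0) -> (forall i, (vs i).[s] = h.1.2 i 0) ->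
  (forall i, (ws i).[s] = h.2 i 0) -> curve_den.[s] = 1 /\ curve s = h.
Proof.
move=> [hv hw] u v w.
have dvs : dv.[s] = 1.
  by rewrite horner_sum -[RHS]hv; apply: eq_bigr => i _; rewrite hornerM u v.
have dws : dw.[s] = 1.
  by rewrite horner_sum -[RHS]hw; apply: eq_bigr => i _; rewrite hornerM u w.
split; first by rewrite hornerM dvs dws mulr1.
rewrite /curve dvs dws [RHS]surjective_pairing [in RHS](surjective_pairing h.1).
by congr (_, _, _); apply/colP => i; rewrite mxE ?divr1.
Qed.

Lemma curve0 : family h0 -> curve_den.[0] = 1 /\ curve 0 = h0.
Proof. by move=> hF; apply: curve_at => // i; apply: segment0. Qed.

Lemma curve1 : family h1 -> curve_den.[1] = 1 /\ curve 1 = h1.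
Proof. by move=> hF; apply: curve_at => // i; apply: segment1. Qed.

(** The outer variable is the parameter [t] of a germ; the coefficients are polynomials in the
    parameter [s] of the interpolation. *)
Definition eval2 (s t : C) (P : {poly {poly C}}) : C :=
  (map_poly (horner_eval s) P).[t].

Let eval2C s t (c : {poly C}) : eval2 s t c%:P = c.[s].
Proof. by rewrite /eval2 map_polyC hornerC. Qed.

Let eval2D s t P Q : eval2 s t (P + Q) = eval2 s t P + eval2 s t Q.
Proof. by rewrite /eval2 rmorphD hornerD. Qed.

Let eval2N s t P : eval2 s t (- P) = - eval2 s t P.
Proof. by rewrite /eval2 rmorphN hornerN. Qed.

Let eval2M s t P Q : eval2 s t (P * Q) = eval2 s t P * eval2 s t Q.
Proof. by rewrite /eval2 rmorphM hornerM. Qed.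

Let eval2Xn s t i : eval2 s t 'X^i = t ^+ i.
Proof. by rewrite /eval2 map_polyXn hornerXn. Qed.

Let eval2E := (eval2C, eval2Xn, eval2D, eval2N, eval2M).

(** The two factors clear the poles at [t = 0] and at the zeros of [curve_den]. Unlike [M], the
    exponent [N] is exposed, because it has to be uniform in [h0] and [h1]. *)
Definition curve_poly_spec (p : {mpoly C[n + n]}) N :=
  exists M (P : {poly {poly C}}), forall s t, curve_den.[s] != 0 -> t != 0 ->
    eval2 s t P = t ^+ N * curve_den.[s] ^+ M * p.@[coords (germ (curve s) t)].

Lemma curve_poly_specC c : curve_poly_spec c%:MP 0.
Proof.
exists 0%N, c%:P%:P => s t _ _.
by rewrite mevalC !expr0 !mul1r eval2C hornerC.
Qed.

Lemma curve_poly_specM p q N1 N2 : curve_poly_spec p N1 ->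
  curve_poly_spec q N2 -> curve_poly_spec (p * q) (N1 + N2).
Proof.
move=> [M1 [P hP]] [M2 [Q hQ]]; exists (M1 + M2)%N, (P * Q) => s t ds t0.
by rewrite eval2M hP // hQ // rmorphM !exprD /=; ring.
Qed.

Lemma curve_poly_specD p q N1 N2 : curve_poly_spec p N1 ->
  curve_poly_spec q N2 -> curve_poly_spec (p + q) (N1 + N2).
Proof.
move=> [M1 [P hP]] [M2 [Q hQ]].
exists (M1 + M2)%N, ('X^N2 * (curve_den ^+ M2)%:P * P +
  'X^N1 * (curve_den ^+ M1)%:P * Q) => s t ds t0.
by rewrite !eval2E hP // hQ // rmorphD !exprD /= !horner_exp; ring.
Qed.

(** This [N] makes [N + a], [N - a] and [N + b] nonnegative; one factor [dv * dw] clears both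
    denominators of a y-coordinate. *)
Lemma curve_poly_specX i : curve_poly_spec 'X_i (`|a| + `|b|)%N.
Proof.
set N := (`|a| + _)%N.
have shift t (k : int) : t != 0 -> 0 <= N%:Z + k ->
    t ^+ absz (N%:Z + k) = t ^+ N * t ^ k :> C.
  by move=> t0 Nk; rewrite !exprnP -expfzDr // gez0_abs.
case: (splitP i) => j ij.
- have -> : i = lshift n j by apply: val_inj.
  exists 0%N, ('X^(absz (N%:Z + a)) * (us j)%:P) => s t _ t0.
  rewrite mevalXU expr0 mulr1 /coords col_mxEu !mxE !eval2E shift //; last by lia.
  by rewrite mulrA.
- have -> : i = rshift n j by apply: val_inj.
  exists 1%N, (('X^(absz (N%:Z - a)) - 'X^(absz (N%:Z + b))) * (vs j * dw)%:P +
    'X^(absz (N%:Z + b)) * (ws j * dv)%:P) => s t.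
  rewrite /curve_den hornerM mulf_eq0 negb_or => /andP[v0 w0] t0.
  rewrite mevalXU expr1 /coords col_mxEd !mxE !eval2E !shift //; try by lia.
  by rewrite !hornerM; field; rewrite v0 w0.
Qed.

End Curve.

Lemma curve_poly p : exists N, forall h0 h1, curve_poly_spec h0 h1 p N.
Proof.
pose Q (p : {mpoly C[n + n]}) :=
  exists N, forall h0 h1, curve_poly_spec h0 h1 p N.
have QC c : Q c%:MP by exists 0%N => h0 h1; apply: curve_poly_specC.
have QD p1 p2 : Q p1 -> Q p2 -> Q (p1 + p2).
  by move=> [N1 H1] [N2 H2]; exists (N1 + N2)%N => *; apply: curve_poly_specD.
have QM p1 p2 : Q p1 -> Q p2 -> Q (p1 * p2).
  by move=> [N1 H1] [N2 H2]; exists (N1 + N2)%N => *; apply: curve_poly_specM.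
rewrite -/(Q p) [p]mpolyE; apply: (big_ind Q) => //; first exact: (QC 0).
move=> k _; rewrite -mul_mpolyC; apply: (QM _ _ (QC _)).
rewrite mpolyXE_id; apply: (big_ind Q) => //; first exact: (QC 1).
move=> i _; elim: (k i) => [|e IH]; first exact: (QC 1).
rewrite exprS; apply: QM => //.
by exists (`|a| + `|b|)%N => h0 h1; apply: curve_poly_specX.
Qed.

(** * The smallest order along the family *)

Definition pullback (p : {mpoly C[n + n]}) (h : triple) (t : C) : C :=
  p.@[coords (germ h t)].

(** One bound on the pole order for all triples is what makes a smallest order exist. *)
Lemma pullback_laurent p : exists N : nat, forall h, family h ->
  exists P, forall t, t != 0 -> pullback p h t = t ^ (- N%:Z) * P.[t].
Proof.
have [N pN] := curve_poly p; exists N => h hF.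
(* The curve from [h] to itself serves only through its point [s = 0], which is [h]. *)
have [M [P hP]] := pN h h; exists (map_poly (horner_eval 0) P) => t t0.
have [d0 c0] := curve0 h hF.
rewrite -[_.[t]]/(eval2 0 t P) hP ?d0 ?oner_eq0 // c0.
by rewrite expr1n mulr1 mulrA exprnP -expfzDr // addNr expr0z mul1r.
Qed.

Definition family_ord p k :=
  (forall h, family h -> ord_ge (pullback p h) k) /\
  (exists2 h, family h & ord_eq (pullback p h) k).

(** The orders along the family are integers at least [- N], and at least one occurs: the diagonal
    triple over a point where [p] is nonzero gives a nonzero pullback. The least one is taken. *)
Lemma family_ord_exists p : p \notin vanishing R m -> exists k, family_ord p k.
Proof.
move=> /asboolPn/existsNP[z /not_implyP[zGH /eqP pz]].
have [N pN] := pullback_laurent p.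
have attained h : family h -> pullback p h 1 != 0 ->
    exists j : nat, ord_eq (pullback p h) (- N%:Z + j%:Z).
  move=> hF p1; have [P hP] := pN h hF.
  have [p0|//] := ord_eq_exists hP.
  by move: p1; rewrite p0 ?oner_eq0 // eqxx.
pose Q j := `[< exists2 h, family h & ord_eq (pullback p h) (- N%:Z + j%:Z) >].
have exQ : exists j, Q j.
  have [|j ordj] := attained _ (family_diag zGH); first by rewrite /pullback germ1.
  by exists j; apply/asboolP; exists (z.1, z.2, z.2) => //; exact: family_diag.
case: (ex_minnP exQ) => j /asboolP Qj minj.
exists (- N%:Z + j%:Z); split => // h hF.
have [P hP] := pN h hF.
have [p0|[i ordi]] := ord_eq_exists hP.
  by exists 0 => t t0; rewrite p0 // horner0 mulr0.
apply: ord_ge_le (ord_eq_ge ordi).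
by rewrite lerD2l lez_nat minj //; apply/asboolP; exists h.
Qed.

Lemma family_ord_uniq p k l : family_ord p k -> family_ord p l -> k = l.
Proof.
move=> [gek [h hF eqk]] [gel [h' hF' eql]]; apply: le_anti.
by rewrite (ord_eq_max eqk (gel _ hF)) (ord_eq_max eql (gek _ hF')).
Qed.

(* In [s], the coefficient of [t ^ k] of the pullback is rational, so it
   vanishes either identically or at finitely many points only. *)
Lemma ord_eq_curve p k h0 h1 s0 :
  (forall h, family h -> ord_ge (pullback p h) k) ->
  (curve_den h0 h1).[s0] != 0 -> ord_eq (pullback p (curve h0 h1 s0)) k ->
  exists2 c : {poly C}, c != 0 &
    forall s, (curve_den h0 h1).[s] != 0 -> c.[s] != 0 ->
      ord_eq (pullback p (curve h0 h1 s)) k.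
Proof.
set d := curve_den h0 h1 => gek ds0 eqk.
have [N /(_ h0 h1)[M [P hP]]] := curve_poly p.
pose e := absz (N%:Z + `|k|%N%:Z + k); pose c := (P * 'X^(`|k|%N))`_e.
have cE s Q : d.[s] != 0 ->
    (forall t, t != 0 -> pullback p (curve h0 h1 s) t = t ^ k * Q.[t]) ->
    c.[s] = d.[s] ^+ M * Q.[0].
  move=> ds hQ.
  have /(congr1 (fun q : {poly C} => q`_e)) :
      map_poly (horner_eval s) (P * 'X^(`|k|%N)) =
      (d.[s] ^+ M) *: (Q * 'X^e).
    apply: poly_eq_punctured => t t0.
    rewrite rmorphM /= map_polyXn hornerZ [LHS]hornerM (hornerM Q) !hornerXn.
    rewrite -[_.[t]]/(eval2 s t P) hP // -/(pullback p _ t) hQ //.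
    rewrite (_ : t ^+ e = t ^+ N * t ^+ `|k|%N * t ^ k).
      by move: (t ^ k) => z; ring.
    by rewrite !exprnP -!expfzDr //; congr (t ^ _); rewrite /e; lia.
  by rewrite coef_map coefZ [X in _ = _ * X]coefMXn ltnn subnn -horner_coef0.
exists c.
  apply/eqP => c0; case: eqk => Q Q0 /(cE _ _ ds0).
  rewrite c0 horner0 => /esym/eqP.
  by rewrite (negbTE (mulf_neq0 (expf_neq0 M ds0) Q0)).
move=> s ds cs; have [Q hQ] := gek _ (curve_family ds).
exists Q => //; apply: contraNneq cs => Q0.
by rewrite (cE _ _ ds hQ) Q0 mulr0.
Qed.

(** The minima of [p] and [q] may be attained at different triples [h0] and [h1]; on the curve
    joining them, some [s] avoids the zeros of [curve_den], [cp] and [cq], and attains both. *)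
Lemma family_ordM p q k l : family_ord p k -> family_ord q l ->
  family_ord (p * q) (k + l).
Proof.
move=> [pge [h0 h0F peq]] [qge [h1 h1F qeq]].
have pqE h t : pullback p h t * pullback q h t = pullback (p * q) h t.
  by rewrite /pullback [RHS]rmorphM.
split=> [h hF|].
  by apply: ord_ge_ext (ord_geM (pge h hF) (qge h hF)) => t _; apply: pqE.
have [d0 c0] := curve0 h1 h0F; have [d1 c1] := curve1 h0 h1F.
have ds0 : (curve_den h0 h1).[0] != 0 by rewrite d0 oner_eq0.
have ds1 : (curve_den h0 h1).[1] != 0 by rewrite d1 oner_eq0.
rewrite -c0 in peq; rewrite -c1 in qeq.
have [cp cp0 hcp] := ord_eq_curve pge ds0 peq.
have [cq cq0 hcq] := ord_eq_curve qge ds1 qeq.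
have dn0 : curve_den h0 h1 != 0.
  by apply: contraNneq ds0 => ->; rewrite horner0.
have /exists_nonroot[s] : curve_den h0 h1 * (cp * cq) != 0.
  by apply: mulf_neq0 => //; apply: mulf_neq0.
rewrite (hornerM (curve_den h0 h1)) (hornerM cp) !mulf_eq0 !negb_or.
move=> /and3P[ds cps cqs].
exists (curve h0 h1 s); first exact: curve_family.
by apply: ord_eq_ext (ord_eqM (hcp s ds cps) (hcq s ds cqs)) => t _; apply: pqE.
Qed.

(** It suffices to compare orders at a triple where [p + q] attains its minimum. *)
Lemma family_ordD p q k l r : family_ord p k -> family_ord q l ->
  family_ord (p + q) r -> Num.min k l <= r.
Proof.
move=> [pge _] [qge _] [_ [h hF eqr]]; apply: (ord_eq_max eqr).
have mk : Num.min k l <= k by rewrite ge_min lexx.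
have ml : Num.min k l <= l by rewrite ge_min lexx orbT.
apply: ord_ge_ext (ord_geD (ord_ge_le mk (pge h hF)) (ord_ge_le ml (qge h hF))).
by move=> t _; rewrite /pullback [RHS]rmorphD.
Qed.

(** Germs stay in G/H for [t != 0], so the order depends only on the class in C[G/H]. *)
Lemma family_ord_ext p q k :
  (forall z, GH R m z -> p.@[coords z] = q.@[coords z]) ->
  family_ord p k -> family_ord q k.
Proof.
move=> pq [ge [h hF eqk]].
have pqE h' : family h' -> forall t, t != 0 -> pullback p h' t = pullback q h' t.
  by move=> h'F t t0; apply/pq/germ_GH.
split=> [h' h'F|]; first exact: ord_ge_ext (pqE _ h'F) (ge _ h'F).
by exists h => //; apply: ord_eq_ext (pqE _ hF) eqk.
Qed.

(** * Invariance under SL_n and orders of the coordinates *)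

Definition triple_act (A : 'M[C]_n) (h : triple) : triple :=
  (SLact A h.1, invmx A^T *m h.2).

Lemma germ_act A h t : germ (triple_act A h) t = SLact A (germ h t).
Proof. by rewrite /germ /SLact /= mulmxDr -!scalemxAr. Qed.

Lemma family_act A h : \det A = 1 -> family h -> family (triple_act A h).
Proof.
by move=> dA [h1 h2]; split; [exact: SLact_GH | exact: (SLact_GH dA h2)].
Qed.

Lemma SLact_invK (A : 'M[C]_n) z : A \in unitmx -> SLact A (SLact (invmx A) z) = z.
Proof.
move=> uA; rewrite /SLact /= !mulmxA mulmxV // mul1mx -!trmx_inv invmxK -trmx_mul.
by rewrite mulmxV // trmx1 mul1mx -surjective_pairing.
Qed.

(** [A] permutes the family compatibly with germs; a triple attaining the minimum for [p] is moved
    by the inverse of [A]. *)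
Lemma family_ord_pull A p k : \det A = 1 -> family_ord p k ->
  family_ord (pull_poly A p) k.
Proof.
move=> dA [ge [h hF eqk]].
have uA : A \in unitmx by rewrite unitmxE dA unitr1.
have pA h' t : pullback (pull_poly A p) h' t = pullback p (triple_act A h') t.
  by rewrite /pullback pull_polyE germ_act.
split=> [h' h'F|].
  by apply: ord_ge_ext (ge _ (family_act dA h'F)) => t _; rewrite pA.
exists (triple_act (invmx A) h).
  by apply: family_act => //; rewrite det_inv dA invr1.
by apply: ord_eq_ext eqk => t _; rewrite /pullback pull_polyE germ_act SLact_invK.
Qed.

(** Test triples: with [i] last and [j] first, [u] has last coordinate 1, while [v] and [w] have
    first coordinates 0 and 1, so the orders of [x_n] and [y_1] are attained. *)
Lemma family_basis i j : i != j ->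
  family (delta_mx i 0, delta_mx i 0, delta_mx i 0 + delta_mx j 0).
Proof.
have sum1 (v : 'cV[C]_n) : v i 0 = 1 ->
    \sum_k (delta_mx i 0 : 'cV[C]_n) k 0 * v k 0 = 1.
  move=> vi; rewrite (bigD1 i) //= big1 ?addr0 ?mxE ?eqxx ?mul1r //.
  by move=> k ki; rewrite mxE (negbTE ki) mul0r.
move=> ij; split; rewrite /GH /= sum1 // !mxE ?eqxx //.
by rewrite (negbTE ij) addr0.
Qed.

Lemma family_ordC c : c != 0 -> family_ord c%:MP 0.
Proof.
move=> c0; have cE h t : pullback c%:MP h t = t ^ 0 * c%:P.[t].
  by rewrite /pullback mevalC hornerC expr0z mul1r.
split=> [h hF|]; first by exists c%:P => t _; apply: cE.
have [z zGH] := GH_nonempty R m; exists (z.1, z.2, z.2); first exact: family_diag.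
by exists c%:P; rewrite ?hornerC // => t _; apply: cE.
Qed.

Lemma family_ord_x_last : (0 < m)%N -> family_ord 'X_(lshift n ord_max) a.
Proof.
move=> m0.
have xE h t : pullback 'X_(lshift n ord_max) h t = t ^ a * (h.1.1 ord_max 0)%:P.[t].
  by rewrite /pullback mevalXU /coords col_mxEu mxE hornerC.
split=> [h hF|]; first by exists (h.1.1 ord_max 0)%:P => t _; apply: xE.
exists (delta_mx ord_max 0, delta_mx ord_max 0,
        delta_mx ord_max 0 + delta_mx ord0 0).
  by apply: family_basis; rewrite -val_eqE /= -lt0n.
eexists; last by move=> t _; apply: xE.
by rewrite hornerC mxE !eqxx oner_eq0.
Qed.

(** The sign of [a + b] enters through [t ^ (- a) - t ^ b = t ^ b * (t ^ (- a - b) - 1)], whose last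
    factor is then a polynomial. *)
Lemma family_ord_y_first : a + b <= 0 -> (0 < m)%N ->
  family_ord 'X_(rshift n ord0) b.
Proof.
move=> ab m0; pose Q (h : triple) : {poly C} :=
  ('X^(absz (- a - b)) - 1) * (h.1.2 ord0 0)%:P + (h.2 ord0 0)%:P.
have yE h t : t != 0 -> pullback 'X_(rshift n ord0) h t = t ^ b * (Q h).[t].
  move=> t0; rewrite /pullback mevalXU /coords col_mxEd !mxE !hornerE mulrDr.
  rewrite [in RHS]mulrA mulrBr mulr1 exprnP -expfzDr // gez0_abs; last by lia.
  by rewrite [b + _]addrC subrK.
split=> [h hF|]; first by exists (Q h) => t; apply: yE.
exists (delta_mx ord_max 0, delta_mx ord_max 0,
        delta_mx ord_max 0 + delta_mx ord0 0).
  by apply: family_basis; rewrite -val_eqE /= -lt0n.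
eexists; last by move=> t; apply: yE.
have max0 : (ord0 == ord_max :> 'I_n) = false by rewrite -val_eqE /= eq_sym gtn_eqF.
by rewrite /Q !hornerE /= !mxE max0 !eqxx mulr0 !add0r oner_eq0.
Qed.

End Family.

(** * Invariant valuations *)

Section FamilyValuation.
Set Implicit Arguments.
Unset Strict Implicit.
Variables (R : realType) (m : nat) (a b : int) (c : rat).
Hypotheses (ab : a + b <= 0) (c_gt0 : 0 < c).
Local Notation n := m.+1.
Local Notation C := R[i].

(* The default value 0 is only reached at [u = 0]. *)
Definition regular_ord (u : regGH R m) : int :=
  xget 0 [set k | family_ord a b (repr u : {mpoly C[n + n]}) k].

(** A polynomial vanishing on G/H has zero pullbacks, whose order exceeds every [k]. *)
Lemma family_ord_nonvanishing (p : {mpoly C[n + n]}) k :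
  family_ord a b p k -> p \notin vanishing R m.
Proof.
move=> [_ [h hF eqk]]; apply/vanishingP => p0.
have : ord_ge (pullback a b p h) (k + 1).
  by exists 0 => t t0; rewrite horner0 mulr0; apply/p0/germ_GH.
by move/(ord_eq_max eqk); lia.
Qed.

Lemma regular_eq0 (p : {mpoly C[n + n]}) :
  (regular p == 0) = (p \in vanishing R m).
Proof.
have r0 : 0 = regular (0 : {mpoly C[n + n]}) by exact/esym/raddf0.
apply/eqP/vanishingP => [|p0].
  by rewrite r0 => /(proj1 (regular_eq _ _)) pq z /pq ->; rewrite raddf0.
by rewrite r0; apply: (proj2 (regular_eq _ _)) => z /p0 ->; rewrite raddf0.
Qed.

(** The order may be computed on any representative, not only on the one chosen by [repr]. *)
Lemma regular_ordE (p : {mpoly C[n + n]}) k : family_ord a b p k ->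
  regular_ord (regular p) = k.
Proof.
move=> pk; have rk : family_ord a b (repr (regular p) : {mpoly C[n + n]}) k.
  apply: family_ord_ext pk => // z zGH; apply/esym.
  by apply: (proj1 (regular_eq _ _)) zGH; rewrite regularK.
rewrite /regular_ord; case: xgetP => [l _ /= rl|/(_ k)//].
exact: family_ord_uniq rl rk.
Qed.

Lemma regular_ordP (u : regGH R m) : u != 0 ->
  family_ord a b (repr u : {mpoly C[n + n]}) (regular_ord u).
Proof.
rewrite -{1}[u]regularK regular_eq0 => /(family_ord_exists a b)[k uk].
by rewrite -{2}[u]regularK (regular_ordE uk).
Qed.

Lemma regular_ordM (u v : regGH R m) : u != 0 -> v != 0 ->
  regular_ord (u * v) = regular_ord u + regular_ord v.
Proof.
move=> u0 v0; rewrite -{1}[u]regularK -{1}[v]regularK -rmorphM.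
apply: regular_ordE.
exact: family_ordM (regular_ordP u0) (regular_ordP v0).
Qed.

Lemma regular_ordD (u v : regGH R m) : u != 0 -> v != 0 -> u + v != 0 ->
  Num.min (regular_ord u) (regular_ord v) <= regular_ord (u + v).
Proof.
move=> u0 v0 uv0; apply: family_ordD (regular_ordP u0) (regular_ordP v0) _.
apply: family_ord_ext (regular_ordP uv0) => // z zGH.
by apply: (proj1 (regular_eq _ _)) zGH; rewrite rmorphD /= !regularK.
Qed.

Lemma regular_ord_pull A (u : regGH R m) : \det A = 1 -> u != 0 ->
  regular_ord (pull_reg A u) = regular_ord u.
Proof.
move=> dA u0; apply: regular_ordE; apply: family_ord_pull => //.
exact: regular_ordP.
Qed.

(** The factor [c] lets integer exponents [a] and [b] reach rational values. *)
Definition fun_val (f : funGH R m) : rat :=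
  c * (regular_ord (\n_(repr f)) - regular_ord (\d_(repr f)))%:~R.

(** Two fractions for the same function cross-multiply to one equality in C[G/H], and
    multiplicativity of the order concludes. *)
Lemma fun_valE (u v : regGH R m) : u != 0 -> v != 0 ->
  fun_val (tofrac u / tofrac v) = c * (regular_ord u - regular_ord v)%:~R.
Proof.
move=> u0 v0; set f := tofrac u / tofrac v; rewrite /fun_val.
set p := \n_(repr f); set q := \d_(repr f).
have q0 : q != 0 by exact: denom_ratioP.
have fE : f = tofrac p / tofrac q by exact: fraction_numden.
have cross : p * v = u * q.
  by apply/eqP; rewrite -tofrac_eq !tofracM -eqr_div ?tofrac_eq0 // -fE.
have p0 : p != 0.
  apply: contraNneq (mulf_neq0 u0 q0) => p0.
  by rewrite -cross p0 mul0r.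
have := regular_ordM p0 v0; rewrite cross (regular_ordM u0 q0) => ordE.
by congr (c * _%:~R); lia.
Qed.

Lemma funGH_frac (f : funGH R m) : f != 0 ->
  exists u v : regGH R m, [/\ u != 0, v != 0 & f = tofrac u / tofrac v].
Proof.
move=> f0; exists (\n_(repr f)), (\d_(repr f)).
split; [|exact: denom_ratioP|exact: fraction_numden].
by apply: contraNneq f0 => n0; rewrite (fraction_numden f) n0 tofrac0 mul0r.
Qed.

Lemma fun_val_fregular (p : {mpoly C[n + n]}) k : family_ord a b p k ->
  fun_val (fregular p) = c * k%:~R.
Proof.
move=> pk; rewrite /fregular -[tofrac _]divr1 -tofrac1 fun_valE ?oner_eq0 //.
  have -> : 1 = regular (1 : {mpoly C[n + n]}) by exact/esym/rmorph1.
  rewrite (regular_ordE pk) (@regular_ordE 1 0) ?subr0 //.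
  by apply: family_ordC; rewrite ?oner_eq0.
by rewrite regular_eq0 (family_ord_nonvanishing pk).
Qed.

Lemma fun_val_invariant : invariant_valuation fun_val.
Proof.
split.
- split=> f g /funGH_frac[u [v [u0 v0 ->]]] /funGH_frac[u' [v' [u'0 v'0 ->]]].
    rewrite mulf_div -!tofracM !fun_valE ?mulf_neq0 // !regular_ordM //.
    by rewrite -mulrDr -intrD; congr (c * _%:~R); lia.
  (* Over a common denominator the inequality concerns the numerators only. *)
  rewrite addf_div ?tofrac_eq0 // -!tofracM -tofracD => fg0.
  have s0 : u * v' + u' * v != 0.
    by apply: contraNneq fg0 => ->; rewrite tofrac0 mul0r.
  rewrite !fun_valE ?mulf_neq0 // -(minr_pMr _ _ (ltW c_gt0)) ler_pM2l //.
  have := regular_ordD (mulf_neq0 u0 v'0) (mulf_neq0 u'0 v0) s0.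
  rewrite !regular_ordM //.
  move: (regular_ord (_ + _)) (regular_ord u) (regular_ord v) => r i j.
  move: (regular_ord u') (regular_ord v') => k l.
  by rewrite !ge_min !ler_int => /orP[] ?; apply/orP; [left|right]; lia.
- by exists c => f _;
    exists (regular_ord (\n_(repr f)) - regular_ord (\d_(repr f))).
- move=> e e0; rewrite (@fun_val_fregular _ 0) ?mulr0 //.
  exact: family_ordC.
- move=> A f dA /funGH_frac[u [v [u0 v0 ->]]].
  by rewrite pullE // !fun_valE ?pull_reg_eq0 // !regular_ord_pull.
Qed.

Lemma valuation_cone_weights : (0 < m)%N ->
  valuation_cone R m (c * a%:~R, c * b%:~R).
Proof.
move=> m0; exists fun_val; split; first exact: fun_val_invariant.
rewrite /x_last /y_first (fun_val_fregular (family_ord_x_last R a b m0)).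
by rewrite (fun_val_fregular (family_ord_y_first R ab m0)).
Qed.

End FamilyValuation.

(** * The half-plane bound for invariant valuations *)

Section ValuationConeBound.
Set Implicit Arguments.
Unset Strict Implicit.
Variables (R : realType) (m : nat).
Local Notation n := m.+1.
Local Notation C := R[i].

Lemma fregular_eq (p q : {mpoly C[n + n]}) :
  (forall z, GH R m z -> p.@[coords z] = q.@[coords z]) ->
  fregular p = fregular q.
Proof. by move=> pq; congr tofrac; apply: (proj2 (regular_eq _ _)). Qed.

Lemma fregularM (p q : {mpoly C[n + n]}) :
  fregular (p * q) = fregular p * fregular q.
Proof. by rewrite /fregular rmorphM tofracM. Qed.

Lemma pull_fregular A (p : {mpoly C[n + n]}) : \det A = 1 ->
  pull A (fregular p) = fregular (pull_poly A p).
Proof.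
move=> dA; have r1 : 1 = regular (1 : {mpoly C[n + n]}) by exact/esym/rmorph1.
rewrite /fregular -[X in pull A X]divr1 -tofrac1 pullE ?oner_eq0 // !pull_regE //.
by rewrite r1 pull_regE // /pull_poly rmorph1 -r1 tofrac1 divr1.
Qed.

(** Since [nu] is unspecified at 0, the induction carries the bound for nonzero partial sums
    only. *)
Lemma valuation_sum_ge (K : fieldType) (nu : K -> rat) (I : Type) (r : seq I)
    (F : I -> K) (c : rat) :
  is_valuation nu -> (forall i, F i != 0 -> c <= nu (F i)) ->
  \sum_(i <- r) F i != 0 -> c <= nu (\sum_(i <- r) F i).
Proof.
move=> [_ nuD] cF; pose Q f := f != 0 -> c <= nu f.
rewrite -/(Q _); apply: (big_ind Q) => [|f g Qf Qg fg0|i _]; last exact: cF.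
  by rewrite /Q eqxx.
have [f0|f0] := eqVneq f 0; first by move: fg0; rewrite f0 add0r; apply: Qg.
have [g0|g0] := eqVneq g 0; first by move: fg0; rewrite g0 addr0; apply: Qf.
by apply: le_trans (nuD _ _ f0 g0 fg0); rewrite le_min Qf ?Qg.
Qed.

(** A transposition matrix has determinant -1; negating one row puts it in SL_n. *)
Definition signed_swap (i j : 'I_n) : 'M[C]_n :=
  diag_mx (\row_k (if k == i then -1 else 1)) *m tperm_mx i j.

Lemma signed_swapE i j (z : 'cV[C]_n) :
  (signed_swap i j *m z) i 0 = - z j 0.
Proof.
rewrite /signed_swap -mulmxA mul_diag_mx !mxE eqxx mulN1r; congr (- _).
rewrite (bigD1 j) //= big1 => [|k kj]; rewrite !mxE perm.tpermL.
  by rewrite eqxx mul1r addr0.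
by rewrite eq_sym (negbTE kj) mul0r.
Qed.

Lemma det_signed_swap i j : i != j -> \det (signed_swap i j) = 1.
Proof.
move=> ij; rewrite /signed_swap det_mulmx det_diag det_perm perm.odd_tperm ij.
rewrite (bigD1 i) //= big1 => [|k /negbTE ki]; rewrite mxE ?eqxx ?ki //.
by rewrite mulr1 expr1 mulrNN mulr1.
Qed.

(** The matrix is orthogonal, so it acts on [y] as it does on [x]. *)
Lemma signed_swap_inv i j : invmx (signed_swap i j)^T = signed_swap i j.
Proof.
rewrite /signed_swap; set D := diag_mx _; set A := D *m _.
have DD : D *m D = 1%:M.
  rewrite mulmx_diag -[RHS]diag_const_mx; congr diag_mx; apply/rowP => k.
  by rewrite !mxE; case: ifP; rewrite ?mulrNN mulr1.
have AA : A^T *m A = 1%:M.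
  rewrite /A trmx_mul tr_diag_mx -mulmxA (mulmxA D) DD mul1mx.
  by rewrite tr_perm_mx perm.tpermV -perm_mxM perm.tperm2 perm_mx1.
have /andP[uA _] : (A^T \in unitmx) && (A \in unitmx).
  by rewrite -unitmx_mul AA unitmx1.
by rewrite -[LHS]mulmx1 -AA mulmxA mulVmx // mul1mx.
Qed.

Lemma GH_delta i : GH R m (delta_mx i 0, delta_mx i 0).
Proof.
rewrite /GH /= (bigD1 i) //= big1 ?addr0 ?mxE ?eqxx ?mulr1 //.
by move=> k /negbTE ki; rewrite !mxE ki mul0r.
Qed.

Lemma fregular_neq0 (p : {mpoly C[n + n]}) z : GH R m z -> p.@[coords z] != 0 ->
  fregular p != 0.
Proof.
move=> zGH pz; rewrite tofrac_eq0 regular_eq0.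
by apply/vanishingP => /(_ z zGH)/eqP/(negP pz).
Qed.

Lemma x_neq0 (i : 'I_n) : fregular ('X_(lshift n i) : {mpoly C[n + n]}) != 0.
Proof.
apply: (fregular_neq0 (GH_delta i)).
by rewrite mevalXU /coords col_mxEu mxE !eqxx oner_eq0.
Qed.

Lemma y_neq0 (i : 'I_n) : fregular ('X_(rshift n i) : {mpoly C[n + n]}) != 0.
Proof.
apply: (fregular_neq0 (GH_delta i)).
by rewrite mevalXU /coords col_mxEd mxE !eqxx oner_eq0.
Qed.

Section Invariant.
Variable nu : funGH R m -> rat.
Hypothesis nu_inv : invariant_valuation nu.

(** The sign is harmless because the constant -1 has value 0. *)
Lemma invariant_valuationN (p q : {mpoly C[n + n]}) A :
  \det A = 1 -> fregular p != 0 -> fregular q != 0 ->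
  (forall z, GH R m z -> p.@[coords (SLact A z)] = - q.@[coords z]) ->
  nu (fregular p) = nu (fregular q).
Proof.
move=> dA p0 q0 pq; case: nu_inv => [[nuM _] _ nuC nuA].
have c0 : fregular ((-1)%:MP : {mpoly C[n + n]}) != 0.
  by apply: (fregular_neq0 (GH_delta 0)); rewrite mevalC oppr_eq0 oner_eq0.
rewrite -(nuA A) // pull_fregular // (@fregular_eq _ ((-1)%:MP * q)).
  by rewrite fregularM nuM // nuC ?add0r // oppr_eq0 oner_eq0.
by move=> z zGH; rewrite pull_polyE pq // rmorphM /= mevalC mulN1r.
Qed.

Lemma invariant_valuation_x i j :
  nu (fregular 'X_(lshift n i)) = nu (fregular 'X_(lshift n j)).
Proof.
have [->//|ij] := eqVneq i j.
apply: (invariant_valuationN (det_signed_swap ij)); try exact: x_neq0.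
by move=> z _; rewrite !mevalXU /coords !col_mxEu signed_swapE.
Qed.

Lemma invariant_valuation_y i j :
  nu (fregular 'X_(rshift n i)) = nu (fregular 'X_(rshift n j)).
Proof.
have [->//|ij] := eqVneq i j.
apply: (invariant_valuationN (det_signed_swap ij)); try exact: y_neq0.
by move=> z _; rewrite !mevalXU /coords !col_mxEd /= signed_swap_inv signed_swapE.
Qed.

Lemma invariant_valuation_le0 : nu (x_last R m) + nu (y_first R m) <= 0.
Proof.
case: (nu_inv) => [nuV _ nuC _]; have [nuM _] := nuV.
pose F (i : 'I_n) : funGH R m := fregular ('X_(lshift n i) * 'X_(rshift n i)).
(* The equation of G/H, read in the function field. *)
have F1 : \sum_i F i = fregular (1%:MP).
  rewrite /F /fregular -rmorph_sum -rmorph_sum; apply: fregular_eq => z zGH.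
  rewrite mevalC rmorph_sum -[RHS]zGH; apply: eq_bigr => i _.
  by rewrite rmorphM /= !mevalXU /coords col_mxEu col_mxEd.
have F0 : \sum_i F i != 0.
  by rewrite F1; apply: (fregular_neq0 (GH_delta 0)); rewrite mevalC oner_eq0.
have Fge i : F i != 0 -> nu (x_last R m) + nu (y_first R m) <= nu (F i).
  move=> _; rewrite /F fregularM (nuM _ _ (x_neq0 i) (y_neq0 i)).
  rewrite (invariant_valuation_x i ord_max) (invariant_valuation_y i ord0).
  exact: lexx.
by have := valuation_sum_ge nuV Fge F0; rewrite F1 nuC ?oner_eq0.
Qed.

End Invariant.
End ValuationConeBound.

(** * The image of the spherical logarithm *)

Section SphericalLogImage.
Set Implicit Arguments.
Unset Strict Implicit.
Variables (R : realType) (m : nat).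
Local Notation n := m.+1.
Local Notation C := R[i].
Local Notation normc := ComplexField.Normc.normc.

Lemma sqnorm_ge0 (x : 'cV[C]_n) : 0 <= sqnorm x.
Proof. by apply: sumr_ge0 => i _; apply: sqr_ge0. Qed.

(** Triangle inequality applied to the equation of G/H. *)
Lemma GH_norm_ge1 z : GH R m z -> 1 <= \sum_i normc (z.1 i 0) * normc (z.2 i 0).
Proof.
move=> zGH; rewrite -lecR rmorph_sum /= -[leLHS](normr1 C) -zGH.
apply: le_trans (ler_norm_sum _ _ _) _; apply: ler_sum => i _.
by rewrite normrM rmorphM.
Qed.

Lemma GH_sqnorm_gt0 z : GH R m z -> 0 < sqnorm z.1.
Proof.
move=> zGH; rewrite lt0r sqnorm_ge0 andbT; apply/negP => /eqP z0.
have := GH_norm_ge1 zGH; rewrite big1 ?ler10 // => i _.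
have : normc (z.1 i 0) ^+ 2 == 0.
  move/eqP: z0; rewrite psumr_eq0 => [/allP/(_ i)|k _]; last exact: sqr_ge0.
  by apply; rewrite mem_index_enum.
by rewrite sqrf_eq0 => /eqP ->; rewrite mul0r.
Qed.

(** Summing the weighted AM-GM inequality over the coordinates gives [2 <= 1 + X * sqnorm z.2]. *)
Lemma GH_sqnormM z : GH R m z -> 1 <= sqnorm z.1 * sqnorm z.2.
Proof.
move=> zGH; set X := sqnorm z.1; have X0 : 0 < X by exact: GH_sqnorm_gt0.
(* AM-GM: [2 u v <= u^2 / X + X v^2] *)
have amgm (u v : R) : (u * v) *+ 2 <= u ^+ 2 / X + X * v ^+ 2.
  rewrite -subr_ge0 (_ : _ - _ = (u - X * v) ^+ 2 / X).
    by rewrite divr_ge0 ?sqr_ge0 ?ltW.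
  by field; rewrite gt_eqF.
have : \sum_i (normc (z.1 i 0) * normc (z.2 i 0)) *+ 2 <= 1 + X * sqnorm z.2.
  rewrite -[X in X + _](@divff _ X) ?gt_eqF // [in X in X + _]/X.
  rewrite mulr_suml mulr_sumr.
  by rewrite -big_split; apply: ler_sum => i _; apply: amgm.
by rewrite sumrMnl; have := GH_norm_ge1 zGH; lra.
Qed.

Lemma sLog_image (t : R) : (0 < m)%N -> 0 < t -> t < 1 ->
  sLog t @` GH R m = [set q : R * R | q.1 + q.2 <= 0].
Proof.
move=> m0 t0 t1; have lnt : ln t < 0 by rewrite ln_lt0 ?t0.
apply/seteqP; split => [_ [z zGH <-]|[q1 q2] /= q0].
  have X0 := GH_sqnorm_gt0 zGH; have XY := GH_sqnormM zGH.
  have Y0 : 0 < sqnorm z.2 by rewrite -(pmulr_rgt0 _ X0); apply: lt_le_trans XY.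
  (* Dividing by [ln t < 0] turns a nonnegative logarithm into a nonpositive sum. *)
  rewrite /sLog /log /= -mulrDl -lnM ?posrE //.
  by rewrite ler_ndivrMr // mul0r ln_ge0.
pose X := expR (q1 * ln t); pose Y := expR (q2 * ln t).
have X0 : 0 < X by exact: expR_gt0.
have XY : 1 <= X * Y.
  rewrite /X /Y -expRD -mulrDl -(@expR0 R) ler_expR.
  by apply: mulr_le0 => //; apply: ltW.
have YX : 0 <= Y - X^-1 by rewrite subr_ge0 -div1r ler_pdivrMr // mulrC.
have sX : Num.sqrt X != 0 by rewrite gt_eqF // sqrtr_gt0.
(* The [e_1] components pair to 1 and contribute [X^-1] to the squared norm of [y]; the [e_n]
   component of [y] does not meet [x] and supplies the missing [Y - X^-1]. *)
pose x : 'cV[C]_n := (Num.sqrt X)%:C%C *: delta_mx ord0 0.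
pose y : 'cV[C]_n := ((Num.sqrt X)^-1)%:C%C *: delta_mx ord0 0 +
  (Num.sqrt (Y - X^-1))%:C%C *: delta_mx ord_max 0.
have max0 : (ord_max == ord0 :> 'I_n) = false by rewrite -val_eqE /= gtn_eqF.
have normcR (r : R) : normc r%:C%C ^+ 2 = r ^+ 2.
  by rewrite /= expr0n /= addr0 sqrtr_sqr real_normK ?num_real.
have xE i : x i 0 = if i == ord0 then (Num.sqrt X)%:C%C else 0.
  by rewrite !mxE andbT; case: eqP; rewrite ?mulr1 ?mulr0.
have yE i : y i 0 = if i == ord0 then ((Num.sqrt X)^-1)%:C%C
    else if i == ord_max then (Num.sqrt (Y - X^-1))%:C%C else 0.
  rewrite !mxE !andbT; have [->|i0] := eqVneq i ord0.
    by rewrite eq_sym max0 mulr1 mulr0 addr0.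
  by rewrite mulr0 add0r; case: eqP; rewrite ?mulr1 ?mulr0.
exists (x, y).
  rewrite /GH /= (bigD1 ord0) //= big1 => [|i /negbTE i0].
    by rewrite xE yE eqxx addr0 -rmorphM /= mulfV.
  by rewrite xE i0 mul0r.
have normc0 : normc (0 : C) ^+ 2 = 0 by rewrite (normcR 0) expr0n.
have nx : sqnorm x = X.
  rewrite /sqnorm (bigD1 ord0) //= big1 => [|i /negbTE i0]; rewrite xE ?i0 //.
  by rewrite eqxx normcR addr0 sqr_sqrtr // ltW.
have ny : sqnorm y = Y.
  rewrite /sqnorm (bigD1 ord0) //= (bigD1 ord_max) ?max0 //=.
  rewrite big1 => [|i /andP[/negbTE i0 /negbTE i1]]; rewrite !yE ?i0 ?i1 //.
  rewrite max0 !eqxx addr0 !normcR exprVn !sqr_sqrtr //; last exact: ltW.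
  by rewrite addrC subrK.
rewrite /sLog /log /= nx ny /X /Y !expRK -!mulrA divff ?lt_eqF //.
by rewrite !mulr1.
Qed.

End SphericalLogImage.

(** * The closure of the valuation cone *)

Lemma valuation_cone_closureE (R : realType) (m : nat) : (0 < m)%N ->
  valuation_cone_closure R m = [set q : R * R | q.1 + q.2 <= 0].
Proof.
move=> m0; apply/seteqP; split => [q|[q1 q2] /= q0].
  have cl : closed [set q : R * R | q.1 + q.2 <= 0].
    have add_cont : continuous (fun q : R * R => q.1 + q.2).
      by move=> x; apply: (@cvgD _ R^o); [exact: cvg_fst | exact: cvg_snd].
    exact: (@preimage_closed _ _ _ [set r : R | r <= 0]
      (fun x _ => add_cont x) (@closed_le R 0)).
  rewrite [X in _ -> X q]((closure_id _).1 cl); apply: closure_subset.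
  move=> _ [_ [nu [nu_inv ->]] <-] /=.
  by rewrite -rmorphD /= lerq0; apply: invariant_valuation_le0.
move=> U [[U1 U2] /= [/nbhs_ballP[e1 /= e10 b1] /nbhs_ballP[e2 /= e20 b2]] U12].
(* Rational approximations are taken strictly below [q1] and [q2], so their sum is negative. *)
have [r1] : exists r, ratr r \in `]q1 - e1, q1[ by apply: rat_in_itvoo; lra.
have [r2] : exists r, ratr r \in `]q2 - e2, q2[ by apply: rat_in_itvoo; lra.
rewrite !in_itv /= => /andP[l2 u2] /andP[l1 u1].
have r0 : r1 + r2 < 0 by rewrite -(@ltrq0 R) rmorphD /=; lra.
exists (ratr r1, ratr r2); split; last first.
  by apply: U12; split => /=; [apply: b1 | apply: b2];
    rewrite /ball /= ltr_norml; lra.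
exists (r1, r2) => //.
(* Both rationals are put over the common denominator [denq r1 * denq r2], whose inverse is [c]. *)
pose a := numq r1 * denq r2; pose b := numq r2 * denq r1.
pose c : rat := ((denq r1 * denq r2)%:~R)^-1.
have d0 (r : rat) : (denq r)%:~R != 0 :> rat by rewrite intr_eq0 denq_neq0.
have c0 : 0 < c by rewrite invr_gt0 ltr0z mulr_gt0 ?denq_gt0.
have r1E : r1 = c * a%:~R.
  by rewrite /c /a -{1}[r1]divq_num_den !intrM; field; rewrite !d0.
have r2E : r2 = c * b%:~R.
  by rewrite /c /b -{1}[r2]divq_num_den !intrM; field; rewrite !d0.
rewrite r1E r2E; apply: valuation_cone_weights => //.
by rewrite -(@lerz0 rat) intrD -(pmulr_rle0 _ c0) mulrDr -r1E -r2E ltW.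
Qed.

(* The dimension n of the text is m.+1. *)
Theorem proposition4p9 (R : realType) (m : nat) (hn : (3 <= m.+1)%N) :
  (forall t : R, 0 < t -> t < 1 ->
     sLog t @` GH R m = valuation_cone_closure R m /\
     valuation_cone_closure R m = [set q : R * R | q.1 + q.2 <= 0]) /\
  kuratowski_cvg (fun t : R => sLog t @` GH R m) (valuation_cone_closure R m).
Proof.
have m0 : (0 < m)%N by lia.
have clE := valuation_cone_closureE R m0.
have sLogE t : 0 < t -> t < 1 -> sLog t @` GH R m = valuation_cone_closure R m.
  by move=> t0 t1; rewrite clE sLog_image.
split=> [t t0 t1|]; first by split=> //; apply: sLogE.
(* The sets equal their limit for [0 < t < 1], so [eps = 1] serves both conditions: a point of the
   limit is its own witness, and off the limit the open complement is the neighbourhood. *)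
split=> [y yV|y yV U yU]; last first.
  exists 1; split => // t t0 t1; exists y; split; last exact: nbhs_singleton.
  by rewrite sLogE.
exists (~` valuation_cone_closure R m); split.
  by apply: open_nbhs_nbhs; split => //; apply/closed_openC/closed_closure.
by exists 1; split => // t t0 t1; rewrite sLogE // setICr.
Qed.
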